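(* Let $((F,\nu,N),[\cdot,\cdot]_{F,h},(\rho,\eta))$ be a generalized Lie algebroid, $(g,h)$ and $(\overset{*}{g},h)$ locally invertible vector bundle morphisms from $(E,\pi,M)$, respectively its dual $(E^*,\overset{*}{\pi},M)$, to $(F,\nu,N)$. Let $L$ be a Lagrange fundamental function on $(E,\pi,M)$ and $H$ its Legendre transformation. Let $u=u^as_a\in\Gamma(E,\pi,M)$ and write $\overset{*}{u}=u_bs^b:=\Gamma(\varphi_L,\mathrm{Id}_M)(u)$. If $$\Gamma((\rho,\eta)T\varphi_L,\varphi_L)(u^C)=\big(\Gamma(\varphi_L,\mathrm{Id}_M)(u)\big)^C,$$ then $$(g^{\alpha e}u_e)\circ\overset{*}{\pi}=(g^\alpha_eu^e)\circ\pi\circ\varphi_H,$$ $$U_a\,[K^{\gamma a}(\overset{*}{u})\circ h\circ\overset{*}{\pi}]\,(\tilde g_{b\gamma}\circ\overset{*}{\pi})=\{U^a(K^\gamma_a(u)\circ h\circ\pi)(\tilde g^c_\gamma\circ\pi)L_{cb}\}\circ\varphi_H-\{(\rho^i_\alpha\circ h\circ\pi)((g^\alpha_eu^e)\circ\pi)L_{ib}\}\circ\varphi_H.$$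
   Context: Repeated indices are summed. $M,N$ are $m$-dimensional manifolds, $h:M\to N$, $\eta:N\to M$ diffeomorphisms; a generalized Lie algebroid consists of a vector bundle $(F,\nu,N)$, a vector bundle morphism $(\rho,\eta)$ from $(F,\nu,N)$ to $(TM,\tau_M,M)$ with local components $\rho^i_\alpha$ (functions on $N$), and a Lie bracket on $\Gamma(F,\nu,N)$ satisfying $[z,fw]_{F,h}=f[z,w]_{F,h}+(\Gamma(Th\circ\rho,h\circ\eta)(z)f)w$, where $\Gamma(Th\circ\rho,h\circ\eta)(z^\alpha t_\alpha)(f)=z^\alpha\rho_\alpha^i\big(\tfrac{\partial(f\circ h)}{\partial x^i}\circ h^{-1}\big)$, $(t_\alpha)$ a local frame of $F$. $(E,\pi,M)$ has rank $r$, local frame $(s_a)$, coordinates $(x^i,y^a)$, vector fields $\partial_i,\dot\partial_a$; its dual $(E^*,\overset{*}{\pi},M)$ has dual frame $(s^a)$, coordinates $(x^i,p_a)$, vector fields $\overset{*}{\partial}_i,\dot\partial^a$. $U^a$ is the local function $y^a$ on $E$ and $U_a$ the local function $p_a$ on $E^*$. $g:E\to F$ and $\overset{*}{g}:E^*\to F$ cover $h$, with components $g^\alpha_b$, $g^{\alpha b}$ (functions on $M$) and inverse matrices $\tilde g^b_\alpha$, $\tilde g_{b\alpha}$. $\Gamma(g,h)(u^as_a)=((g^\alpha_au^a)\circ h^{-1})t_\alpha$, $\Gamma(\overset{*}{g},h)(u_as^a)=((g^{\alpha a}u_a)\circ h^{-1})t_\alpha$. $K^\gamma_a(u)$ and $K^{\gamma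 a}(\overset{*}{u})$ are defined by $[\Gamma(g,h)u,\Gamma(g,h)s_a]_{F,h}=K^\gamma_a(u)t_\gamma$ and $[\Gamma(\overset{*}{g},h)\overset{*}{u},\Gamma(\overset{*}{g},h)s^a]_{F,h}=K^{\gamma a}(\overset{*}{u})t_\gamma$. $(\rho,\eta)TE\subset(h\circ\pi)^*F\oplus TE$ is the vector bundle over $E$ with local frame $\tilde\partial_\alpha=T_\alpha\oplus(\rho^i_\alpha\circ h\circ\pi)\partial_i$, $\dot{\tilde\partial}_a=0\oplus\dot\partial_a$ ($T_\alpha$ induced by $t_\alpha$); $(\rho,\eta)TE^*\subset(h\circ\overset{*}{\pi})^*F\oplus TE^*$ has local frame $\overset{*}{\tilde\partial}_\alpha=\overset{*}{T}_\alpha\oplus(\rho^i_\alpha\circ h\circ\overset{*}{\pi})\overset{*}{\partial}_i$, $\dot{\tilde\partial}{}^a=0\oplus\dot\partial^a$. Complete lifts: $$u^C=((g^\alpha_eu^e)\circ\pi)\tilde\partial_\alpha-U^a(K^\gamma_a(u)\circ h\circ\pi)(\tilde g^b_\gamma\circ\pi)\dot{\tilde\partial}_b,$$ $$\overset{*}{u}{}^C=((g^{\alpha e}u_e)\circ\overset{*}{\pi})\overset{*}{\tilde\partial}_\alpha-U_a(K^{\gamma a}(\overset{*}{u})\circ h\circ\overset{*}{\pi})(\tilde g_{b\gamma}\circ\overset{*}{\pi})\dot{\tilde\partial}{}^b.$$ A Lagrange fundamental function is $L:E\to\mathbb R$ with $L\circ u\in C^\infty(M)$ for every nonzero section $u$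 and $L\circ0\in C^0(M)$; the derivatives $L_{ab}=\partial^2L/\partial y^a\partial y^b$, $L_{ib}=\partial^2L/\partial x^i\partial y^b$ are taken to exist (off the zero section). Legendre morphism $\varphi_L:E\to E^*$, $u^as_a(x)\mapsto u^aL_{ab}(u_x)s^b(x)$; on sections $\Gamma(\varphi_L,\mathrm{Id}_M)(u)=(u^a(L_{ab}\circ u))s^b$. The Legendre transformation of $L$ is the Hamilton fundamental function $H$ on $E^*$ (defined by the same regularity conditions) given locally by $H(\overset{*}{u}_x)=u_au^a-L(u_x)$ for $\overset{*}{u}_x=u_as^a(x)$, where $u_x=u^as_a(x)$ solves $u_b=u^aL_{ab}(u_x)$, $b=1,\dots,r$. $\varphi_H:E^*\to E$, $u_as^a(x)\mapsto u_aH^{ab}(\overset{*}{u}_x)s_b(x)$, $H^{ab}=\partial^2H/\partial p_a\partial p_b$. The tangent $(\rho,\eta)$-application $((\rho,\eta)T\varphi_L,\varphi_L)$ acts on sections additively by $$\Gamma((\rho,\eta)T\varphi_L,\varphi_L)(Z^\alpha\tilde\partial_\alpha)=(Z^\alpha\circ\varphi_H)\overset{*}{\tilde\partial}_\alpha+\big([(\rho^i_\alpha\circ h\circ\pi)Z^\alpha L_{ib}]\circ\varphi_H\big)\dot{\tilde\partial}{}^b,$$ $$\Gamma((\rho,\eta)T\varphi_L,\varphi_L)(Y^a\dot{\tilde\partial}_a)=\big((Y^aL_{ab})\circ\varphi_H\big)\dot{\tilde\partial}{}^b.$$ All identities are understood where the functions involved are defined. *)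

(* Defs.v *)
From HB Require Import structures.
From mathcomp Require Import all_boot all_order all_algebra.
From mathcomp Require Import all_classical all_reals all_analysis.

Set Implicit Arguments.
Unset Strict Implicit.
Unset Printing Implicit Defensive.

Import Order.TTheory GRing.Theory Num.Theory.
Import numFieldNormedType.Exports.

Local Open Scope classical_set_scope.
Local Open Scope ring_scope.

Section Smooth.
Context {R : realType}.

Definition partial n (i : 'I_n) (f : 'rV[R]_n -> R) (y : 'rV[R]_n) : R :=
  'D_(delta_mx 0 i : 'rV[R]_n) f y.

Definition partial_exists n (i : 'I_n) (f : 'rV[R]_n -> R) (y : 'rV[R]_n) :=
  derivable f y (delta_mx 0 i : 'rV[R]_n).

(* C^k on an open set [A] *)
Fixpoint diff_upto n (k : nat) (A : set 'rV[R]_n) (f : 'rV[R]_n -> R) : Prop :=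
  (forall y, A y -> {for y, continuous f}) /\
  match k with
  | 0 => True
  | k.+1 => forall i : 'I_n,
      (forall y, A y -> partial_exists i f y) /\ diff_upto k A (partial i f)
  end.

Definition smooth_on n (A : set 'rV[R]_n) (f : 'rV[R]_n -> R) :=
  forall k, diff_upto k A f.

(* [cmap] and [cinv] are total; they are only meaningful on [cdom] and on
   [cmap @` cdom]. *)
Record coords (X : Type) n := Coords {
  cdom : set X;
  cmap : X -> 'rV[R]_n;
  cinv : 'rV[R]_n -> X
}.

(* Since the charts in [C] will always be pairwise compatible, one chart around
   [x] is enough. *)
Definition smooth_at X n (C : set (coords X n)) (f : X -> R) (x : X) :=
  exists c, [/\ C c, cdom c x &
    exists A, [/\ open A, A (cmap c x) & smooth_on A (f \o cinv c)]].

(* Tangent vectors of X at x are derivations of the functions that are smooth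
   at x, extended by 0 to all other functions. *)
Definition tvec (X : Type) : lmodType R := ((X -> R) -> R^o)%type.

Definition coord_vec X n (C : set (coords X n)) (c : coords X n) (i : 'I_n)
    (x : X) : tvec X :=
  fun f => if `[< smooth_at C f x >] then partial i (f \o cinv c) (cmap c x)
           else 0.

(* [d2 f c i j x] is the derivative with respect to the i-th coordinate of the
   derivative with respect to the j-th one. *)
Definition d2 X n (f : X -> R) (c : coords X n) (i j : 'I_n) (x : X) : R :=
  partial i (partial j (f \o cinv c)) (cmap c x).

Definition d2_exists X n (f : X -> R) (c : coords X n) (i j : 'I_n) (x : X) :=
  (\forall y \near cmap c x, partial_exists j (f \o cinv c) y) /\
  partial_exists i (partial j (f \o cinv c)) (cmap c x).

End Smooth.

Arguments coords : clear implicits.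
Arguments tvec : clear implicits.

Section Manifolds.
Context {R : realType}.

Definition local_chart n (X : topologicalType) (c : coords R X n) :=
  [/\ open (cdom c), open (cmap c @` cdom c),
      forall x, cdom c x -> cinv c (cmap c x) = x,
      forall x, cdom c x -> {for x, continuous (cmap c)} &
      forall y, (cmap c @` cdom c) y -> {for y, continuous (cinv c)}].

Record manifold n := Manifold {
  mcar :> topologicalType;
  atlas : set (coords R mcar n);
  man_hausdorff : hausdorff_space mcar;
  man_countable : @second_countable mcar;
  atlas_chart : forall c, atlas c -> local_chart c;
  atlas_cover : forall x, exists2 c, atlas c & cdom c x;
  atlas_compat : forall c c', atlas c -> atlas c' -> forall j : 'I_n,
    smooth_on (cmap c @` (cdom c `&` cdom c'))
      (fun y => cmap c' (cinv c y) 0 j)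
}.

Arguments atlas {n} m _.

Definition smooth_fun n (M : manifold n) (f : M -> R) :=
  forall x, smooth_at (atlas M) f x.

Definition smooth_map m n (M : manifold m) (N : manifold n) (h : M -> N) :=
  continuous h /\
  forall x c, atlas N c -> cdom c (h x) -> forall j : 'I_n,
    smooth_at (atlas M) (fun z => cmap c (h z) 0 j) x.

Record diffeo m (M N : manifold m) := Diffeo {
  dfun :> M -> N;
  dinv : N -> M;
  dfunK : cancel dfun dinv;
  dinvK : cancel dinv dfun;
  dfun_smooth : smooth_map dfun;
  dinv_smooth : smooth_map dinv
}.

End Manifolds.

Arguments atlas {R n} m _.
Arguments manifold : clear implicits.

Section Bundles.
Context {R : realType}.

Record frame (X : Type) (E : X -> vectType R) r := Frame {
  fdom : set X;
  fvec : forall x, r.-tuple (E x)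
}.

Definition fcoord X (E : X -> vectType R) r (s : frame E r) (x : X) (a : 'I_r)
    (v : E x) : R := coord (fvec s x) a v.

Definition fsec X (E : X -> vectType R) r (s : frame E r) (a : 'I_r) (x : X)
  : E x := tnth (fvec s x) a.

(* The smooth structure of a vector bundle is given by an atlas of local frames
   (equivalently, of local trivializations). *)
Record vbundle n (M : manifold R n) r := VBundle {
  fib :> M -> vectType R;
  frames : set (frame fib r);
  frames_open : forall s, frames s -> open (fdom s);
  frames_basis : forall s, frames s -> forall x, fdom s x ->
    basis_of fullv (fvec s x);
  frames_cover : forall x, exists2 s, frames s & fdom s x;
  frames_compat : forall s s', frames s -> frames s' -> forall x,
    fdom s x -> fdom s' x -> forall a b,
    smooth_at (atlas M) (fun z => fcoord s' b (fsec s a z)) x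
}.

Arguments frames {n M r} v _.

Definition section n (M : manifold R n) r (E : vbundle M r) :=
  forall x : M, E x.

Definition smooth_sec_at n (M : manifold R n) r (E : vbundle M r)
    (u : section E) (x : M) :=
  exists s, [/\ frames E s, fdom s x &
    forall a, smooth_at (atlas M) (fun z => fcoord s a (u z)) x].

Definition smooth_sec n (M : manifold R n) r (E : vbundle M r)
    (u : section E) := forall x, smooth_sec_at u x.

Definition total_space n (M : manifold R n) r (E : vbundle M r) :=
  {x : M & E x}.

Definition bcoords n (M : manifold R n) r (E : vbundle M r)
    (c : coords R M n) (s : frame E r) : coords R (total_space E) (n + r) :=
  Coords [set e | cdom c (tag e) /\ fdom s (tag e)]
    (fun e => row_mx (cmap c (tag e)) (\row_a fcoord s a (tagged e)))
    (fun y => let x := cinv c (lsubmx y) in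
       Tagged (fib E) (\sum_a rsubmx y 0 a *: fsec s a x)).

Definition batlas n (M : manifold R n) r (E : vbundle M r)
    : set (coords R (total_space E) (n + r)) :=
  [set k | exists c s, [/\ atlas M c, frames E s & k = bcoords c s]].

Definition base_ix n r (i : 'I_n) : 'I_(n + r) := lshift r i.
Definition fibre_ix n r (a : 'I_r) : 'I_(n + r) := rshift n a.

End Bundles.

Arguments frames {R n M r} v _.
Arguments batlas {R n M r} E _.

Section Dual.
Context {R : realType}.

Definition dual_fib X (E : X -> vectType R) (x : X) : vectType R :=
  'Hom(E x, R^o).

Definition dual_frame X (E : X -> vectType R) r (s : frame E r)
    : frame (dual_fib E) r :=
  Frame (fdom s)
    (fun x => [tuple (linfun (coord (fvec s x) b) : dual_fib E x) | b < r]).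

Lemma coord_tnth (V : vectType R) r (X : r.-tuple V) (a b : 'I_r) :
  basis_of fullv X -> coord X b (tnth X a) = (a == b)%:R.
Proof.
by move=> /basis_free fX; rewrite (tnth_nth 0) coord_free.
Qed.

Lemma dual_basis X (E : X -> vectType R) r (s : frame E r) x :
  basis_of fullv (fvec s x) -> basis_of fullv (fvec (dual_frame s) x).
Proof.
move=> bs; have fs : free (fvec (dual_frame s) x).
  apply/freeP => k /lfunP k0 a.
  have := k0 (tnth (fvec s x) a).
  rewrite sum_lfunE zero_lfunE (bigD1 a) //= big1 => [|b ba].
    rewrite addr0 scale_lfunE (nth_map a) ?size_enum_ord //.
    by rewrite nth_ord_enum lfunE /= coord_tnth // eqxx => /eqP;
      rewrite scaler_eq0 oner_eq0 orbF => /eqP.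
  rewrite scale_lfunE (nth_map b) ?size_enum_ord //.
  by rewrite nth_ord_enum lfunE /= coord_tnth // eq_sym (negbTE ba) scaler0.
rewrite basisEfree fs subvf /= size_tuple.
rewrite dimvf card_ord -[X in (X <= _)%N]/(dim (E x) * 1)%N muln1.
by rewrite -dimvf (size_basis bs).
Qed.

Lemma dual_coord X (E : X -> vectType R) r (s : frame E r) x
    (w : dual_fib E x) a :
  basis_of fullv (fvec s x) ->
  fcoord (dual_frame s) a w = w (fsec s a x).
Proof.
move=> bs; have bd := dual_basis bs.
rewrite [in RHS](coord_basis bd (memvf w)) sum_lfunE (bigD1 a) //= big1.
  rewrite addr0 scale_lfunE (nth_map a) ?size_enum_ord //.
  rewrite nth_ord_enum lfunE /= coord_tnth // eqxx.
  by rewrite /GRing.scale /= mulr1.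
move=> b ba; rewrite scale_lfunE (nth_map b) ?size_enum_ord //.
by rewrite nth_ord_enum lfunE /= coord_tnth // eq_sym (negbTE ba) scaler0.
Qed.


Lemma diff_upto_eq n k (A B : set 'rV[R]_n) (f f' : 'rV[R]_n -> R) :
  open B -> B `<=` A -> (forall y, B y -> f y = f' y) ->
  diff_upto k A f -> diff_upto k B f'.
Proof.
move=> oB BA; elim: k f f' => [|k IH] f f' ff' [cf pf].
all: have e y : B y -> \forall z \near y, f z = f' z.
1,3: by move=> By; apply: filterS (open_nbhs_nbhs (conj oB By)) => z /ff'.
all: have cf' y : B y -> {for y, continuous f'}.
1,3: move=> By; rewrite /prop_for /continuous_at -ff' //.
1,2: by apply: cvg_trans _ (cf y (BA _ By));
  apply: near_eq_cvg; [exact: (nbhs_filter y)|exact: e].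
  by split.
split=> // i; have [d p] := pf i; split=> [y By|].
  by apply: near_eq_derivable (d _ (BA _ By)) => //; exact: e.
by apply: IH p => y By; apply: near_eq_derive; exact: e.
Qed.

Lemma smooth_at_eq n (M : manifold R n) (f f' : M -> R) x :
  (\forall z \near x, f z = f' z) ->
  smooth_at (atlas M) f x -> smooth_at (atlas M) f' x.
Proof.
move=> ff' [c [ac dx [A [oA Ax sf]]]].
have [_ _ cK _ ci] := atlas_chart ac.
have cx : (cmap c @` cdom c) (cmap c x) by exists x.
have : nbhs (cmap c x) [set y | f (cinv c y) = f' (cinv c y)].
  have := ci _ cx; rewrite /prop_for /continuous_at cK // => /(_ _ ff').
  by [].
rewrite nbhsE => -[B [oB By] BP].
exists c; split=> //; exists (A `&` B); split=> //; first exact: openI.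
by move=> k; apply: diff_upto_eq (sf k) => [|y []|y [_ /BP]] //; exact: openI.
Qed.

Definition dual_bundle n (M : manifold R n) r (E : vbundle M r) : vbundle M r.
Proof.
exists (dual_fib E) [set d | exists2 s, frames E s & d = dual_frame s].
- by move=> _ [s /frames_open os ->].
- by move=> _ [s fs ->] x dx; apply/dual_basis/(frames_basis fs).
- move=> x; have [s fs sx] := frames_cover E x.
  by exists (dual_frame s) => //; exists s.
- move=> _ _ [s fs ->] [s' fs' ->] x /= sx s'x a b.
  apply: smooth_at_eq (frames_compat fs' fs s'x sx b a).
  have : nbhs x (fdom s') by apply: open_nbhs_nbhs; split=> //;
    exact: frames_open.
  apply: filterS => z s'z; rewrite dual_coord; last exact: frames_basis s'z.
  by rewrite /fsec tnth_mktuple lfunE.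
Defined.

End Dual.

Section LieAlgebroids.
Context {R : realType}.

(* A bundle morphism over h with smooth components; it maps the fibre at x to
   the fibre at h x. *)
Record vbmorphism m n (M : manifold R m) (N : manifold R n) (h : M -> N)
    r p (E : vbundle M r) (F : vbundle N p) := VBMorphism {
  vbfun :> forall x, 'Hom(E x, F (h x));
  vb_smooth : forall s t, frames E s -> frames F t ->
    forall x, fdom s x -> fdom t (h x) -> forall a alpha,
    smooth_at (atlas M) (fun z => fcoord t alpha (vbfun z (fsec s a z))) x
}.

Definition locally_invertible m n (M : manifold R m) (N : manifold R n)
    (h : M -> N) r p (E : vbundle M r) (F : vbundle N p)
    (g : vbmorphism h E F) := forall x, bijective (g x).

Context {m p : nat} {M N : manifold R m}.
Context (h : diffeo M N) (eta : diffeo N M) (F : vbundle N p).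

(* rho^i_alpha, read off as the value of the tangent vector rho(t_alpha(k)) on
   the coordinate function x^i. *)
Definition anchor_coord (rho : forall k : N, F k -> tvec R M) (c : coords R M m)
    (t : frame F p) (i : 'I_m) (alpha : 'I_p) (k : N) : R :=
  @rho k (fsec t alpha k) (fun x => cmap c x 0 i).

(* Bundle morphisms from F to TM over eta. *)
Record anchor := Anchor {
  afun :> forall k : N, F k -> tvec R M;
  anchor_linear : forall k, linear (@afun k);
  anchor_local : forall c t, atlas M c -> frames F t ->
    forall k, fdom t k -> cdom c (eta k) -> forall alpha,
    @afun k (fsec t alpha k) =
      \sum_i anchor_coord afun c t i alpha k *:
        coord_vec (atlas M) c i (eta k) /\
    forall i, smooth_at (atlas N) (anchor_coord afun c t i alpha) k
}.

(* Gamma(Th o rho, h o eta)(z)(f) in the coordinates x^i of c. As the components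
   rho^i_alpha(k) refer to eta(k) and the partial derivatives to h^-1(k), both
   points have to lie in the domain of c. *)
Definition anchor_act (rho : anchor) (c : coords R M m) (t : frame F p)
    (z : section F) (f : N -> R) (k : N) : R :=
  \sum_alpha \sum_i fcoord t alpha (z k) * anchor_coord rho c t i alpha k *
    partial i (f \o h \o cinv c) (cmap c (dinv h k)).

Record gen_lie_algebroid := GenLieAlgebroid {
  gla_anchor : anchor;
  bracket : section F -> section F -> section F;
  bracket_smooth : forall z w, smooth_sec z -> smooth_sec w ->
    smooth_sec (bracket z w);
  bracket_linear : forall (a : R) z z' w,
    smooth_sec z -> smooth_sec z' -> smooth_sec w -> forall k,
    bracket (fun l => a *: z l + z' l) w k =
      a *: bracket z w k + bracket z' w k;
  bracket_linear_r : forall (a : R) z w w',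
    smooth_sec z -> smooth_sec w -> smooth_sec w' -> forall k,
    bracket z (fun l => a *: w l + w' l) k =
      a *: bracket z w k + bracket z w' k;
  bracket_alt : forall z, smooth_sec z -> forall k, bracket z z k = 0;
  bracket_jacobi : forall z w v,
    smooth_sec z -> smooth_sec w -> smooth_sec v -> forall k,
    bracket z (bracket w v) k + bracket w (bracket v z) k +
    bracket v (bracket z w) k = 0;
  bracket_leibniz : forall z w f,
    smooth_sec z -> smooth_sec w -> smooth_fun f ->
    forall c t, atlas M c -> frames F t ->
    forall k, fdom t k -> cdom c (dinv h k) -> cdom c (eta k) ->
    bracket z (fun l => f l *: w l) k =
      f k *: bracket z w k + anchor_act gla_anchor c t z f k *: w k
}.

(* The bracket at k of sections z, w that are only defined and smooth near k:
   by the Leibniz rule it only depends on the germs at k, so that one takes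
   global smooth sections with the same germs. *)
Definition extend (z : section F) (k : N) : section F :=
  match pselect (exists z' : section F,
      smooth_sec z' /\ \forall l \near k, z' l = z l) with
  | left ex => projT1 (cid ex)
  | right _ => z
  end.

Definition local_bracket (A : gen_lie_algebroid) (z w : section F) (k : N)
  : F k := bracket A (extend z k) (extend w k) k.

End LieAlgebroids.

Section CompleteLift.
Context {R : realType} {m p r : nat} {M N : manifold R m}.
Context {h : diffeo M N} {eta : diffeo N M} {F : vbundle N p}.
Context (A : gen_lie_algebroid h eta F) {E : vbundle M r}.
Context (c : coords R M m) (s : frame E r) (t : frame F p).

(* Fibres of (h o pi)^*F (+) TE, which contains (rho, eta)TE. *)
Definition pullback_sum (e : total_space E) : lmodType R :=
  (F (h (tag e)) * tvec R (total_space E))%type.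

Definition rho_coord i alpha (e : total_space E) : R :=
  anchor_coord (gla_anchor A) c t i alpha (h (tag e)).

Definition horizontal_vec (alpha : 'I_p) (e : total_space E)
    : pullback_sum e :=
  (fsec t alpha (h (tag e)),
   \sum_i rho_coord i alpha e *:
     coord_vec (batlas E) (bcoords c s) (base_ix r i) e).

Definition vertical_vec (a : 'I_r) (e : total_space E) : pullback_sum e :=
  (0, coord_vec (batlas E) (bcoords c s) (fibre_ix m a) e).

(* U^a on E, and U_a on the dual bundle *)
Definition fibre_coord (a : 'I_r) (e : total_space E) : R :=
  fcoord s a (tagged e).

Context (g : vbmorphism h E F).

Definition mor_coord (alpha : 'I_p) (a : 'I_r) (x : M) : R :=
  fcoord t alpha (g x (fsec s a x)).

(* Inverse matrix of the components of g when g is locally invertible. *)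
Definition mor_inv_coord (b : 'I_r) (alpha : 'I_p) (x : M) : R :=
  fcoord s b ((g x)^-1%VF (fsec t alpha (h x))).

Definition push_sec (u : section E) : section F := fun k =>
  \sum_alpha (\sum_a mor_coord alpha a (dinv h k) * fcoord s a (u (dinv h k)))
    *: fsec t alpha k.

Definition bracket_coord (gamma : 'I_p) (a : 'I_r) (u : section E) (k : N)
    : R :=
  fcoord t gamma (local_bracket A (push_sec u) (push_sec (fsec s a)) k).

Definition complete_lift (u : section E) (e : total_space E) : pullback_sum e :=
  \sum_alpha (\sum_a mor_coord alpha a (tag e) * fcoord s a (u (tag e)))
    *: horizontal_vec alpha e
  - \sum_b (\sum_a \sum_gamma fibre_coord a e *
              bracket_coord gamma a u (h (tag e)) *
              mor_inv_coord b gamma (tag e)) *: vertical_vec b e.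

End CompleteLift.

Arguments pullback_sum {R m p r M N} h F {E} e.
Arguments vertical_vec {R m p r M N} h F {E} c s a e.

Section Fundamental.
Context {R : realType} {m r : nat} {M : manifold R m} {E : vbundle M r}.

(* Second derivatives L_ab and L_ib in the bundle coordinates of (c, s); for a
   function on the dual bundle, H^ab and H^i_b. *)
Definition vert_hess (c : coords R M m) (s : frame E r) (L : total_space E -> R)
    (a b : 'I_r) (e : total_space E) : R :=
  d2 L (bcoords c s) (fibre_ix m a) (fibre_ix m b) e.

Definition mixed_hess (c : coords R M m) (s : frame E r)
    (L : total_space E -> R) (i : 'I_m) (b : 'I_r) (e : total_space E) : R :=
  d2 L (bcoords c s) (base_ix r i) (fibre_ix m b) e.

Definition vert_hess_exists (c : coords R M m) (s : frame E r)
    (L : total_space E -> R) (e : total_space E) :=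
  forall a b, d2_exists L (bcoords c s) (fibre_ix m a) (fibre_ix m b) e.

Definition mixed_hess_exists (c : coords R M m) (s : frame E r)
    (L : total_space E -> R) (e : total_space E) :=
  forall i b, d2_exists L (bcoords c s) (base_ix r i) (fibre_ix m b) e.

(* "Nonzero section" is read as "nowhere zero section". *)
Definition fundamental_function (L : total_space E -> R) :=
  [/\ forall u : section E, smooth_sec u -> (forall x, u x != 0) ->
        smooth_fun (fun x => L (Tagged (fib E) (u x))),
      continuous (fun x : M => L (Tagged (fib E) (0 : E x))) &
      forall c s, atlas M c -> frames E s ->
        forall e : total_space E, cdom c (tag e) -> fdom s (tag e) ->
        tagged e != 0 ->
        vert_hess_exists c s L e /\ mixed_hess_exists c s L e].

End Fundamental.

Section Legendre.
Context {R : realType} {m r : nat} {M : manifold R m} {E : vbundle M r}.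

Definition legendre_solution (c : coords R M m) (s : frame E r)
    (L : total_space E -> R) (x : M) (q : dual_bundle E x) (v : E x) :=
  forall b, fcoord (dual_frame s) b q =
    \sum_a fcoord s a v * vert_hess c s L a b (Tagged (fib E) v).

(* q in the dual of E_x corresponds to u_a, v in E_x to u^a *)
Definition legendre_transformation (L : total_space E -> R)
    (H : total_space (dual_bundle E) -> R) :=
  fundamental_function H /\
  forall c s, atlas M c -> frames E s ->
  forall x, cdom c x -> fdom s x -> forall q : dual_bundle E x,
    (q != 0 -> exists v : E x, legendre_solution c s L q v) /\
    (forall v : E x, vert_hess_exists c s L (Tagged (fib E) v) ->
       legendre_solution c s L q v ->
       H (Tagged (fib (dual_bundle E)) q) =
         \sum_a fcoord (dual_frame s) a q * fcoord s a v -
         L (Tagged (fib E) v)).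

Context (c : coords R M m) (s : frame E r).

Definition phiL (L : total_space E -> R) (e : total_space E)
    : total_space (dual_bundle E) :=
  Tagged (fib (dual_bundle E))
    (\sum_b (\sum_a fcoord s a (tagged e) * vert_hess c s L a b e)
       *: fsec (dual_frame s) b (tag e)
     : dual_bundle E (tag e)).

Definition phiL_sec (L : total_space E -> R) (u : section E)
    : section (dual_bundle E) :=
  fun x => tagged (phiL L (Tagged (fib E) (u x))).

Definition phiH (H : total_space (dual_bundle E) -> R)
    (q : total_space (dual_bundle E)) : total_space E :=
  Tagged (fib E)
    (\sum_b (\sum_a fcoord (dual_frame s) a (tagged q) *
               vert_hess c (dual_frame s : frame (dual_bundle E) r) H a b q)
       *: fsec s b (tag q)).

End Legendre.

Section TangentMap.
Context {R : realType} {m p r : nat} {M N : manifold R m}.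
Context {h : diffeo M N} {eta : diffeo N M} {F : vbundle N p}.
Context (A : gen_lie_algebroid h eta F) {E : vbundle M r}.
Context (c : coords R M m) (s : frame E r) (t : frame F p).
Context (L : total_space E -> R) (H : total_space (dual_bundle E) -> R).

Notation ds := (dual_frame s : frame (dual_bundle E) r).
Notation phi := (phiH c s H).

(* The components Z^alpha and Y^a of
   X = Z^alpha horizontal_vec alpha + Y^a vertical_vec a; the coordinate function
   y^a is killed by the horizontal vectors, so X(y^a) = Y^a. *)
Definition horizontal_comp (X : forall e : total_space E, pullback_sum h F e)
    (alpha : 'I_p) (e : total_space E) : R := fcoord t alpha (X e).1.

Definition vertical_comp (X : forall e : total_space E, pullback_sum h F e)
    (a : 'I_r) (e : total_space E) : R := (X e).2 (fibre_coord s a).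

Definition tangent_phiL (X : forall e : total_space E, pullback_sum h F e)
    (q : total_space (dual_bundle E)) : pullback_sum h F q :=
  \sum_alpha horizontal_comp X alpha (phi q) *: horizontal_vec A c ds t alpha q
  + \sum_b (\sum_alpha \sum_i rho_coord A c t i alpha (phi q) *
              horizontal_comp X alpha (phi q) * mixed_hess c s L i b (phi q))
      *: vertical_vec h F c ds b q
  + \sum_b (\sum_a vertical_comp X a (phi q) * vert_hess c s L a b (phi q))
      *: vertical_vec h F c ds b q.

(* The points of the dual bundle over the coordinate domains at which all the
   derivatives involved exist and near which phi_L(u) is a smooth section. *)
Definition all_defined (u : section E) : set (total_space (dual_bundle E)) :=
  [set q | [/\ [/\ cdom c (tag q), fdom s (tag q), fdom t (h (tag q)) &
                   cdom c (eta (h (tag q)))],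
               vert_hess_exists c ds H q,
               vert_hess_exists c s L (phi q) /\
               mixed_hess_exists c s L (phi q) &
               (\forall x \near tag q,
                  vert_hess_exists c s L (Tagged (fib E) (u x))) /\
               smooth_sec_at (phiL_sec c s L u) (tag q)]].

End TangentMap.

Arguments all_defined {R m p r M N} h eta {F E} c s t L H u.

(* Main.v *)
Require Import Defs.
From HB Require Import structures.
From mathcomp Require Import all_boot all_order all_algebra.
From mathcomp Require Import all_classical all_reals all_analysis.

Set Implicit Arguments.
Unset Strict Implicit.
Unset Printing Implicit Defensive.

Import Order.TTheory GRing.Theory Num.Theory.
Import numFieldNormedType.Exports.

Local Open Scope classical_set_scope.
Local Open Scope ring_scope.


(** Both sides of the hypothesis are combinations of the same local frame of
    [(rho, eta)TE^*], the horizontal vectors [T_alpha (+) rho_alpha^i d_i] and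
    the vertical vectors [0 (+) d/dp_a], so the two identities are the equality
    of the horizontal and of the vertical coefficients.  The frame is linearly
    independent for two reasons.  The [F]-components of the horizontal vectors
    are a basis of the fibre of [F], while those of the vertical vectors vanish
    ([horizontal_coord_comb]).  Applied to the fibre coordinate [p_b], a
    horizontal vector gives 0 and the vertical vector [d/dp_a] gives the
    Kronecker delta ([vertical_coord_comb]).

    Coordinate vectors are derivations of the functions smooth at a point,
    extended by 0 to all other functions, so the second reason depends on the
    fibre coordinates being smooth: in the bundle chart they are linear
    coordinates on an open set ([coord_vec_fibre_coord]).

    The same two facts, on [E] instead of its dual, give the components of
    [u^C] that enter [tangent_phiL]: the horizontal ones are [g^alpha_e u^e],
    and the vertical ones carry the minus sign of the complete lift, which
    accounts for the signs in the second identity. *)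

Section FibreCoordinates.
Context {R : realType}.

Lemma tvec_sumE (X I : Type) (l : seq I) (P : pred I) (v : I -> tvec R X) f :
  (\sum_(i <- l | P i) v i) f = \sum_(i <- l | P i) v i f.
Proof. by rewrite fct_sumE. Qed.

Lemma tvecZE (X : Type) (a : R) (v : tvec R X) f : (a *: v) f = a * v f.
Proof. by []. Qed.

Lemma is_derive_coord n (y v : 'rV[R]_n) (j : 'I_n) :
  is_derive y v (fun z : 'rV[R]_n => z 0 j) (v 0 j).
Proof.
have dv : derivable (@idfun 'rV[R]_n) y v by exact: derivable_id.
split; first by move/derivable_mxP : dv; apply.
by have := derive_mx dv; rewrite derive_id => /rowP/(_ j); rewrite mxE.
Qed.

Lemma partial_coord n (i j : 'I_n) (y : 'rV[R]_n) :
  partial i (fun z : 'rV[R]_n => z 0 j) y = (i == j)%:R.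
Proof.
have ? := is_derive_coord y (delta_mx 0 i) j.
by rewrite /partial derive_val mxE eqxx eq_sym.
Qed.

Lemma diff_upto_cst n k (A : set 'rV[R]_n) (a : R) : diff_upto k A (cst a).
Proof.
elim: k a => [|k IH] a; split => //; try by move=> y _; exact: cst_continuous.
move=> i; split=> [y _|]; first exact: derivable_cst.
have -> : partial i (cst a) = cst 0 by apply/funext => y; exact: derive_cst.
exact: IH.
Qed.

Lemma smooth_on_coord n (A : set 'rV[R]_n) (j : 'I_n) :
  smooth_on A (fun z => z 0 j).
Proof.
case=> [|k]; split=> //; try by move=> y _; exact: coord_continuous.
move=> i; split=> [y _|]; first by have [] := is_derive_coord y (delta_mx 0 i) j.
have -> : partial i (fun z : 'rV[R]_n => z 0 j) = cst (i == j)%:R.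
  by apply/funext => y; exact: partial_coord.
exact: diff_upto_cst.
Qed.

(** Inside the image of the chart, this is the preimage of [B] under the inverse
    of the chart, which is continuous there. *)
Lemma open_chart_image n (X : topologicalType) (c : coords R X n) (B : set X) :
  local_chart c -> open B -> open (cmap c @` (cdom c `&` B)).
Proof.
move=> [_ oI cK _ ci] oB.
have -> : cmap c @` (cdom c `&` B) = cmap c @` cdom c `&` cinv c @^-1` B.
  apply/seteqP; split=> [_ [x [dx Bx] <-]|_ [[x dx <-]]] /=.
    by rewrite cK //; split=> //; exists x.
  by rewrite cK // => Bx; exists x.
rewrite openE => y [Iy By]; apply: filterI.
  exact: open_nbhs_nbhs.
by apply: (ci _ Iy); exact: open_nbhs_nbhs.
Qed.

Context {m r : nat} {M : manifold R m} {E : vbundle M r}.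
Context (c : coords R M m) (s : frame E r).
Hypotheses (c_atlas : atlas M c) (s_frame : frames E s).

(* The image of the domain of [bcoords c s]: all the fibre coordinates over the
   part of the base chart where the frame [s] is defined. *)
Let chart_dom : set 'rV[R]_(m + r) :=
  lsubmx @^-1` (cmap c @` (cdom c `&` fdom s)).

Lemma fibre_coord_cinv (a : 'I_r) y : chart_dom y ->
  (fibre_coord s a \o cinv (bcoords c s)) y = y 0 (fibre_ix m a).
Proof.
have [_ _ cK _ _] := atlas_chart c_atlas.
move=> [x [dx sx] xy]; rewrite /= /fibre_coord /fcoord /= -xy cK //.
have fs := basis_free (frames_basis s_frame sx).
under eq_bigr => b _ do rewrite /fsec (tnth_nth 0).
by rewrite coord_sum_free // mxE.
Qed.

Lemma open_chart_dom : open chart_dom.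
Proof.
apply: open_comp => [y _|]; first exact: continuous_lsubmx.
apply: open_chart_image; [exact: atlas_chart|exact: frames_open].
Qed.

(** The fibre coordinate is smooth because [bcoords c s] turns it into a linear
    coordinate on the open set [chart_dom]; hence the coordinate vector really
    differentiates it. *)
Lemma coord_vec_fibre_coord (i : 'I_(m + r)) (a : 'I_r) e :
  cdom c (tag e) -> fdom s (tag e) ->
  coord_vec (batlas E) (bcoords c s) i e (fibre_coord s a) =
    (i == fibre_ix m a)%:R.
Proof.
move=> ce se.
have Ae : chart_dom (cmap (bcoords c s) e).
  by rewrite /chart_dom /= row_mxKl; exists (tag e).
have sm : smooth_at (batlas E) (fibre_coord s a) e.
  exists (bcoords c s); split; [by exists c, s|by []|].
  exists chart_dom; split=> //; first exact: open_chart_dom.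
  move=> k; apply: diff_upto_eq open_chart_dom _ _
    (@smooth_on_coord _ setT (fibre_ix m a) k) => //.
  by move=> y /fibre_coord_cinv ->.
rewrite /coord_vec asboolT // -(partial_coord i _ (cmap (bcoords c s) e)).
apply: near_eq_derive.
by apply: filterS (open_nbhs_nbhs (conj open_chart_dom Ae)) => y /fibre_coord_cinv.
Qed.

Context {p : nat} {N : manifold R m} {h : diffeo M N} {eta : diffeo N M}.
Context {F : vbundle N p} (A : gen_lie_algebroid h eta F) (t : frame F p).
Hypothesis t_frame : frames F t.

Definition frame_comb (Z : 'I_p -> R) (Y : 'I_r -> R) (e : total_space E)
    : pullback_sum h F e :=
  \sum_alpha Z alpha *: horizontal_vec A c s t alpha e
  + \sum_b Y b *: vertical_vec h F c s b e.

Lemma horizontal_coord_comb Z Y e alpha : fdom t (h (tag e)) ->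
  fcoord t alpha (frame_comb Z Y e).1 = Z alpha.
Proof.
move=> te; have ft := basis_free (frames_basis t_frame te).
rewrite /frame_comb raddfD !raddf_sum /= [X in _ + X]big1 ?addr0; last first.
  by move=> b _; rewrite scaler0.
rewrite /fcoord.
under eq_bigr => b _ do rewrite /fsec (tnth_nth 0).
exact: coord_sum_free.
Qed.

(** The coordinate vectors of the base, hence the horizontal vectors, kill the
    fibre coordinates. *)
Lemma vertical_coord_comb Z Y e b : cdom c (tag e) -> fdom s (tag e) ->
  (frame_comb Z Y e).2 (fibre_coord s b) = Y b.
Proof.
move=> ce se; rewrite /frame_comb raddfD !raddf_sum /= addrfctE !tvec_sumE.
rewrite [X in X + _]big1 ?add0r => [|alpha _]; last first.
  rewrite tvecZE tvec_sumE big1 ?mulr0 // => i _.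
  by rewrite tvecZE coord_vec_fibre_coord // eq_lrshift mulr0.
rewrite (bigD1 b) //= big1 ?addr0 => [|b' b'b].
  by rewrite tvecZE coord_vec_fibre_coord // eqxx mulr1.
by rewrite tvecZE coord_vec_fibre_coord // eq_rshift (negbTE b'b) mulr0.
Qed.

End FibreCoordinates.

Section Lifts.
Context {R : realType} {m p r : nat} {M N : manifold R m}.
Context {h : diffeo M N} {eta : diffeo N M} {F : vbundle N p}.
Context (A : gen_lie_algebroid h eta F) {E : vbundle M r}.
Context (c : coords R M m) (s : frame E r) (t : frame F p).

Lemma complete_lift_comb (g : vbmorphism h E F) (u : section E) e :
  complete_lift A c s t g u e =
  frame_comb c s A t
    (fun alpha => \sum_a mor_coord s t g alpha a (tag e) *
                    fcoord s a (u (tag e)))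
    (fun b => - \sum_a \sum_gamma fibre_coord s a e *
                  bracket_coord A s t g gamma a u (h (tag e)) *
                  mor_inv_coord s t g b gamma (tag e)) e.
Proof.
rewrite /complete_lift /frame_comb -sumrN; congr (_ + _).
by apply: eq_bigr => b _; rewrite scaleNr.
Qed.

(** Both summands of the tangent map, the one coming from the mixed derivatives
    of [L] and the one coming from its fibre Hessian, are vertical; they add up
    to one vertical coefficient. *)
Lemma tangent_phiL_comb L H (X : forall e : total_space E, pullback_sum h F e)
    (q : total_space (dual_bundle E)) :
  tangent_phiL A c s t L H X q =
  frame_comb c (dual_frame s : frame (dual_bundle E) r) A t
    (fun alpha => horizontal_comp t X alpha (phiH c s H q))
    (fun b => \sum_alpha \sum_i rho_coord A c t i alpha (phiH c s H q) *
                horizontal_comp t X alpha (phiH c s H q) *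
                mixed_hess c s L i b (phiH c s H q)
              + \sum_a vertical_comp s X a (phiH c s H q) *
                  vert_hess c s L a b (phiH c s H q)) q.
Proof.
rewrite /tangent_phiL /frame_comb -addrA; congr (_ + _).
by rewrite -big_split; apply: eq_bigr => b _; rewrite scalerDl.
Qed.

End Lifts.

Theorem theorem51 (R : realType) (m p r : nat) (M N : manifold R m)
  (h : diffeo M N) (eta : diffeo N M) (F : vbundle N p)
  (A : gen_lie_algebroid h eta F) (E : vbundle M r)
  (g : vbmorphism h E F) (gs : vbmorphism h (dual_bundle E) F)
  (g_inv : locally_invertible g) (gs_inv : locally_invertible gs)
  (L : total_space E -> R) (L_lagrange : fundamental_function L)
  (H : total_space (dual_bundle E) -> R) (H_legendre : legendre_transformation L H)
  (u : section E) (u_smooth : smooth_sec u)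
  (c : coords R M m) (c_atlas : atlas M c)
  (s : frame E r) (s_frame : frames E s)
  (t : frame F p) (t_frame : frames F t) :
  let ds : frame (dual_bundle E) r := dual_frame s in
  let us : section (dual_bundle E) := phiL_sec c s L u in
  let phi : total_space (dual_bundle E) -> total_space E := phiH c s H in
  let D : set (total_space (dual_bundle E)) := all_defined h eta c s t L H u in
  (forall q : total_space (dual_bundle E), D q ->
     tangent_phiL A c s t L H (complete_lift A c s t g u) q =
     complete_lift A c ds t gs us q) ->
  forall q : total_space (dual_bundle E), D q ->
    (forall alpha : 'I_p,
       \sum_e mor_coord ds t gs alpha e (tag q) * fcoord ds e (us (tag q)) =
       \sum_e mor_coord s t g alpha e (tag (phi q)) *
              fcoord s e (u (tag (phi q)))) /\
    (forall b : 'I_r,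
       \sum_a \sum_gamma
         fibre_coord ds a q * bracket_coord A ds t gs gamma a us (h (tag q)) *
         mor_inv_coord ds t gs b gamma (tag q) =
       \sum_c' \sum_a \sum_gamma
         fibre_coord s a (phi q) *
         bracket_coord A s t g gamma a u (h (tag (phi q))) *
         mor_inv_coord s t g c' gamma (tag (phi q)) *
         vert_hess c s L c' b (phi q)
       - \sum_alpha \sum_i
         rho_coord A c t i alpha (phi q) *
         (\sum_e mor_coord s t g alpha e (tag (phi q)) *
                 fcoord s e (u (tag (phi q)))) *
         mixed_hess c s L i b (phi q)).

Proof.
move=> ds us phi D lift_eq q Dq; have := lift_eq q Dq.
case: Dq => -[cq sq tq _] _ _ _.
rewrite tangent_phiL_comb complete_lift_comb => comb_eq.
have ds_frame : frames (dual_bundle E) ds by exists s.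
split=> [alpha|b].
  have := congr1 (fun X => fcoord t alpha X.1) comb_eq.
  rewrite !horizontal_coord_comb // => <-.
  by rewrite /horizontal_comp complete_lift_comb horizontal_coord_comb.
have := congr1 (fun X => X.2 (fibre_coord ds b)) comb_eq.
rewrite !vertical_coord_comb // => Y_eq; rewrite -[LHS]opprK -Y_eq.
rewrite opprD addrC -sumrN; congr (_ - _).
  apply: eq_bigr => c' _.
  rewrite /vertical_comp complete_lift_comb vertical_coord_comb //.
  rewrite mulNr opprK mulr_suml.
  by apply: eq_bigr => a _; rewrite mulr_suml.
apply: eq_bigr => alpha _; apply: eq_bigr => i _.
by rewrite /horizontal_comp complete_lift_comb horizontal_coord_comb.
Qed.
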